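(* Let $G$ be a finite simple graph on $n$ vertices without isolated vertices, let $k\ge 2$ be an integer, and let $\pi$ be a proper colouring of $G$ with $k$ colours. Let $\lambda=\lambda_{n-1}$ be the largest eigenvalue of the normalized Laplacian matrix $\mathbf L=\mathbf I-\mathbf D^{-1/2}\mathbf A\mathbf D^{-1/2}$ of $G$. If \[\lambda=\frac{k}{k-1},\] then $\pi$ is equitable with respect to $\mathbf D^{-1}\mathbf A$.
   Context: $\mathbf A$ is the adjacency matrix of $G$ and $\mathbf D$ is the diagonal matrix of vertex degrees. A colouring with $k$ colours is a partition $\pi=\{S_1,\dots,S_k\}$ of $V(G)$ into $k$ (nonempty) independent sets. A partition $\pi=\{S_1,\dots,S_m\}$ of the index set of a square matrix $\mathbf M$ is equitable with respect to $\mathbf M$ if, for all classes $S_i,S_j$, the sum $\sum_{b\in S_j}\mathbf M_{ab}$ takes the same value for all $a\in S_i$. For $\mathbf M=\mathbf D^{-1}\mathbf A$ this says that (number of neighbours of $a$ in $S_j$)$/d(a)$ is the same for all $a\in S_i$, where $d(a)$ is the degree of $a$. *)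

(* Defs.v *)
From mathcomp Require Import all_boot all_order all_algebra.
From mathcomp Require Import reals.
Set Implicit Arguments.
Unset Strict Implicit.
Unset Printing Implicit Defensive.
Import Order.TTheory GRing.Theory Num.Theory.
Local Open Scope ring_scope.

(* A finite simple graph on n vertices is a symmetric irreflexive relation    *)
(* e : rel 'I_n.                                                              *)

Definition no_isolated (n : nat) (e : rel 'I_n) : Prop :=
  forall v : 'I_n, exists w : 'I_n, e v w.

Definition degree (n : nat) (e : rel 'I_n) (v : 'I_n) : nat :=
  #|[set w | e v w]|.

Definition independent (n : nat) (e : rel 'I_n) (S : {set 'I_n}) : Prop :=
  forall u v : 'I_n, u \in S -> v \in S -> ~~ e u v.

(* [partition] excludes the empty block, so all k colour classes are nonempty *)
Definition proper_colouring (n : nat) (e : rel 'I_n) (k : nat)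
    (pi : {set {set 'I_n}}) : Prop :=
  [/\ partition pi [set: 'I_n], #|pi| = k
    & forall S : {set 'I_n}, S \in pi -> independent e S].

Definition equitable (R : nzRingType) (n : nat) (M : 'M[R]_n)
    (pi : {set {set 'I_n}}) : Prop :=
  forall S T : {set 'I_n}, S \in pi -> T \in pi ->
  forall a a' : 'I_n, a \in S -> a' \in S ->
    \sum_(b in T) M a b = \sum_(b in T) M a' b.

Definition adjmx (R : realType) (n : nat) (e : rel 'I_n) : 'M[R]_n :=
  \matrix_(i, j) (e i j)%:R.

Definition degmx (R : realType) (n : nat) (e : rel 'I_n) : 'M[R]_n :=
  diag_mx (\row_i (degree e i)%:R).

(* D^{-1/2}, meaningful when all degrees are positive *)
Definition degmx_rsqrt (R : realType) (n : nat) (e : rel 'I_n) : 'M[R]_n :=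
  diag_mx (\row_i (Num.sqrt (degree e i)%:R)^-1).

Definition norm_laplacian (R : realType) (n : nat) (e : rel 'I_n) : 'M[R]_n :=
  1%:M - degmx_rsqrt R e *m adjmx R e *m degmx_rsqrt R e.

(* Only eigenvalues in the base field count; for a real symmetric matrix      *)
(* these are all of its eigenvalues.                                          *)
Definition largest_eigenvalue (R : realType) (n : nat) (M : 'M[R]_n)
    (lambda : R) : Prop :=
  eigenvalue M lambda /\ forall mu : R, eigenvalue M mu -> mu <= lambda.

(* Main.v *)
Require Import Defs.
From mathcomp Require Import all_boot all_order all_algebra.
From mathcomp Require Import reals.
From mathcomp Require Import sesquilinear spectral complex.
From mathcomp Require Import ring lra.
Set Implicit Arguments.
Unset Strict Implicit.
Unset Printing Implicit Defensive.
Import Order.TTheory GRing.Theory Num.Theory.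
Local Open Scope ring_scope.

(** Write [d] for the degree vector, [1_T] for the indicator vector of a set
    [T], and [vol T] for the sum of the degrees over [T].  Let
    [K = D + (k - 1) A].

    For a row vector [x], put [y = x D^(1/2)].  Then
    [lambda y y^T - y L y^T = (lambda - 1) x D x^T + x A x^T], which for
    [lambda = k / (k - 1)] is [x K x^T / (k - 1)].  The spectral theorem bounds
    [y L y^T] by [lambda y y^T], so [K] is positive semidefinite
    ([symmetric_bform_le_eigenvalue], [hoffmanmx_psd]).

    The vectors [f_T = 1 - k 1_T], for [T] a colour class, are isotropic for
    [K].  Indeed [1 K = k d], while [1_T K 1_T^T = vol T] because [T] carries no
    edge; hence [f_T K f_T^T = k vol V - k^2 vol T].  There are [k] classes and
    their volumes add up to [vol V], so these nonnegative numbers sum to [0] and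
    each of them vanishes.

    An isotropic vector of a positive semidefinite form lies in its kernel
    ([psd_isotropic_ker]), so [f_T K = 0] ([colour_class_ker]).  At a vertex
    [a] this equation reads [d(a) = d(a) [a in T] + (k - 1) |N(a) inter T|].
    So the proportion of neighbours of [a] lying in [T] is [0] if [a] is in [T]
    and [1 / (k - 1)] otherwise, which depends only on the class of [a]. *)

(** * Bilinear forms of matrices *)

Definition bform (R : pzRingType) n (M : 'M[R]_n) (x y : 'rV[R]_n) : R :=
  (x *m M *m y^T) 0 0.

Lemma bformDl (R : pzRingType) n (M : 'M[R]_n) x1 x2 y :
  bform M (x1 + x2) y = bform M x1 y + bform M x2 y.
Proof. by rewrite /bform !mulmxDl mxE. Qed.

Lemma bformDr (R : pzRingType) n (M : 'M[R]_n) x y1 y2 :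
  bform M x (y1 + y2) = bform M x y1 + bform M x y2.
Proof. by rewrite /bform linearD mulmxDr mxE. Qed.

Lemma bformZl (R : pzRingType) n (M : 'M[R]_n) c x y :
  bform M (c *: x) y = c * bform M x y.
Proof. by rewrite /bform -!scalemxAl mxE. Qed.

Lemma bformZr (R : comPzRingType) n (M : 'M[R]_n) c x y :
  bform M x (c *: y) = c * bform M x y.
Proof. by rewrite /bform linearZ -scalemxAr mxE. Qed.

Lemma bform_sym (R : comPzRingType) n (M : 'M[R]_n) x y :
  M^T = M -> bform M x y = bform M y x.
Proof.
move=> M_sym; transitivity ((x *m M *m y^T)^T 0 0); first by rewrite mxE.
by rewrite !trmx_mul trmxK M_sym mulmxA.
Qed.

Lemma bformE (R : pzRingType) n (M : 'M[R]_n) x y :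
  bform M x y = \sum_j (\sum_i x 0 i * M i j) * y 0 j.
Proof. by rewrite /bform mxE; apply: eq_bigr => j _; rewrite !mxE. Qed.

(** * Positive semidefiniteness from the spectral theorem *)

Section Rayleigh.
Local Open Scope sesquilinear_scope.

(** The upper Rayleigh bound.  Over [R[i]] the matrix becomes Hermitian, hence
    unitarily diagonalizable with real spectrum; each diagonal entry is the image
    of a real eigenvalue of [M] itself, so it is bounded by [lambda], and in
    the coordinates [w] of the eigenbasis both sides are weighted sums of the
    squared norms [w_i (w_i)^*]. *)
Lemma symmetric_bform_le_eigenvalue (R : rcfType) n (M : 'M[R]_n) lambda x :
    M^T = M -> (forall mu, eigenvalue M mu -> mu <= lambda) ->
  bform M x x <= lambda * (x *m x^T) 0 0.
Proof.
move=> M_sym M_le; pose toC := real_complex R : {rmorphism R -> R[i]}.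
pose Mc := map_mx toC M; pose xc := map_mx toC x.
have real_map m p (A : 'M[R]_(m, p)) : map_mx Num.conj (map_mx toC A) = map_mx toC A.
  by apply/matrixP => i j; rewrite !mxE; apply/eqP; rewrite eq_complex /= oppr0 !eqxx.
have Mc_herm : Mc \is hermsymmx.
  by apply/is_hermitianmxP; rewrite expr0 scale1r !map_trmx M_sym real_map.
have /hermitian_normalmx/orthomx_spectralP := Mc_herm.
have := hermitian_spectral_diag_real Mc_herm.
have := spectral_unitarymx Mc.
move: (spectralmx Mc) (spectral_diag Mc) => P d P_unit /mxOverP d_real McE.
have P_inv := unitarymx_unit P_unit.
(* the rows of [P] are eigenvectors, nonzero because [P] is invertible *)
have d_le i : d 0 i <= toC lambda.
  have /complex_realP[r dr] := d_real 0 i.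
  rewrite dr lecR; apply: M_le.
  rewrite -(eigenvalue_map toC) -/Mc; apply/eigenvalueP; exists (row i P).
    rewrite McE -row_mul !mulmxA mulmxV // mul1mx row_mul row_diag_mx.
    by rewrite -scalemxAl -rowE dr.
  apply/eqP => P0; have := row_free_unit P; rewrite P_inv => /row_freeP[Q PQ].
  have := congr1 (fun v => (v *m Q) 0 i) P0.
  rewrite -row_mul PQ mul0mx !mxE eqxx => /eqP; by rewrite oner_eq0.
pose w := xc *m P ^t*.
have wt : w ^t* = P *m xc^T.
  by rewrite /w trmx_mul map_mxM trmxCK map_trmx real_map.
have bformC : toC (bform M x x) = \sum_i d 0 i * (w 0 i * (w 0 i)^*).
  have -> : toC (bform M x x) = (xc *m Mc *m xc^T) 0 0.
    by rewrite /xc /Mc map_trmx -!map_mxM mxE.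
  rewrite McE invmx_unitary // !mulmxA -/w -mulmxA -wt mxE.
  by apply: eq_bigr => i _; rewrite mul_mx_diag !mxE mulrAC mulrC mulrA.
have normC : toC ((x *m x^T) 0 0) = \sum_i w 0 i * (w 0 i)^*.
  have -> : toC ((x *m x^T) 0 0) = (xc *m xc^T) 0 0.
    by rewrite /xc map_trmx -!map_mxM [RHS]mxE.
  have -> : xc *m xc^T = w *m w ^t*.
    rewrite wt /w mulmxA -[_ *m _ *m P]mulmxA -invmx_unitary // mulVmx //.
    by rewrite mulmx1.
  by rewrite mxE; apply: eq_bigr => i _; rewrite !mxE.
rewrite -lecR -/toC.
change (toC (bform M x x) <= toC (lambda * (x *m x^T) 0 0)).
rewrite rmorphM /= bformC normC mulr_sumr; apply: ler_sum => i _.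
by apply: ler_wpM2r => //; exact: mul_conjC_ge0.
Qed.
End Rayleigh.

(** A nonnegative quadratic polynomial in [t] without constant term, here
    the value of the form at [x + t y], has no linear term either; so [x] is
    orthogonal to every [y]. *)
Lemma psd_isotropic_ker (R : realFieldType) n (M : 'M[R]_n) x :
    M^T = M -> (forall y, 0 <= bform M y y) -> bform M x x = 0 ->
  x *m M = 0.
Proof.
move=> M_sym M_psd x0.
have ortho y : bform M x y = 0.
  have q_ge0 t : 0 <= 2 * t * bform M x y + t ^+ 2 * bform M y y.
    have := M_psd (x + t *: y).
    rewrite !(bformDl, bformDr, bformZl, bformZr) x0 (bform_sym y x M_sym).
    by congr (0 <= _); ring.
  (* adding 1 to the denominator of the minimizer avoids a case split on
     whether [y] is isotropic *)
  have := q_ge0 (- bform M x y / (bform M y y + 1)).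
  have := M_psd y; move: (bform M x y) (bform M y y) => b q q0.
  have q1 : 0 < q + 1 by lra.
  have -> : 2 * (- b / (q + 1)) * b + (- b / (q + 1)) ^+ 2 * q
    = - (b ^+ 2) * ((q + 2) / (q + 1) ^+ 2) by field; rewrite gt_eqF.
  rewrite pmulr_lge0 ?divr_gt0 ?exprn_gt0 //; last by lra.
  by rewrite oppr_ge0 => b2; apply/eqP; rewrite -sqrf_eq0 eq_le b2 sqr_ge0.
apply/rowP => i; have := ortho (delta_mx 0 i).
by rewrite /bform trmx_delta -colE !mxE.
Qed.

(** * The matrix D + (k - 1) A *)

(** Multiplying [k / (k - 1) - L] by [D^(1/2)] on both sides and by [k - 1]
    gives this matrix, which unlike [L] involves no square root. *)
Definition hoffmanmx (R : realType) n (e : rel 'I_n) (k : nat) : 'M[R]_n :=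
  degmx R e + (k%:R - 1) *: adjmx R e.

Lemma hoffmanmxE (R : realType) n (e : rel 'I_n) k i j :
  hoffmanmx R e k i j
  = (degree e i)%:R *+ (i == j) + (k%:R - 1) * (e i j)%:R.
Proof. by rewrite !mxE. Qed.

Lemma tr_adjmx (R : realType) n (e : rel 'I_n) :
  symmetric e -> (adjmx R e)^T = adjmx R e.
Proof. by move=> e_sym; apply/matrixP => i j; rewrite !mxE e_sym. Qed.

Lemma tr_hoffmanmx (R : realType) n (e : rel 'I_n) k :
  symmetric e -> (hoffmanmx R e k)^T = hoffmanmx R e k.
Proof.
by move=> e_sym; rewrite !linearD linearZ /= tr_diag_mx tr_adjmx.
Qed.

Lemma degree_gt0 n (e : rel 'I_n) v : no_isolated e -> (0 < degree e v)%N.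
Proof.
by move=> /(_ v)[w evw]; apply/card_gt0P; exists w; rewrite inE.
Qed.

Lemma sum_adj_degree (R : pzSemiRingType) n (e : rel 'I_n) v :
  \sum_w (e v w)%:R = (degree e v)%:R :> R.
Proof.
rewrite /degree -sum1_card natr_sum [RHS]big_mkcond /=.
by apply: eq_bigr => w _; rewrite inE; case: (e v w).
Qed.

(** The substitution [y = x D^(1/2)] turns the Rayleigh bound for [L] at [y]
    into [x D x^T - x A x^T <= k / (k - 1) * x D x^T], which rearranges to
    the claim. *)
Lemma hoffmanmx_psd (R : realType) n (e : rel 'I_n) k :
    symmetric e -> no_isolated e -> (2 <= k)%N ->
    (forall mu, eigenvalue (norm_laplacian R e) mu -> mu <= k%:R / (k%:R - 1)) ->
  forall x, 0 <= bform (hoffmanmx R e k) x x.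
Proof.
move=> e_sym e_noiso k_ge2 L_le x.
have k1 : 0 < k%:R - 1 :> R by rewrite subr_gt0 ltr1n.
pose sq : 'M[R]_n := diag_mx (\row_i Num.sqrt (degree e i)%:R).
have sqK : sq *m degmx_rsqrt R e = 1%:M.
  rewrite mulmx_diag -diag_const_mx; congr diag_mx; apply/rowP => i.
  by rewrite !mxE divff // sqrtr_eq0 -ltNge ltr0n degree_gt0.
have Ksq : degmx_rsqrt R e *m sq = 1%:M by apply: mulmx1C.
have sq2 : sq *m sq = degmx R e.
  rewrite mulmx_diag; congr diag_mx; apply/rowP => i.
  by rewrite !mxE -expr2 sqr_sqrtr.
have L_sym : (norm_laplacian R e)^T = norm_laplacian R e.
  by rewrite linearB /= !trmx_mul tr_diag_mx tr_adjmx // trmx1 mulmxA.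
have := symmetric_bform_le_eigenvalue (x *m sq) L_sym L_le.
rewrite /bform /norm_laplacian trmx_mul tr_diag_mx -/sq.
rewrite mulmxBr mulmx1 mulmxBl !mulmxA -(mulmxA x sq sq) sq2.
rewrite -(mulmxA x sq (degmx_rsqrt R e)) sqK mulmx1.
rewrite -(mulmxA _ (degmx_rsqrt R e) sq) Ksq mulmx1.
rewrite /hoffmanmx mulmxDr mulmxDl -scalemxAr -scalemxAl !mxE.
move: (\sum_j _) (\sum_j _) => qD qA.
rewrite mulrAC ler_pdivlMr // => le_q; lra.
Qed.

(** * Colour classes *)

Definition indrv (R : pzRingType) n (S : {set 'I_n}) : 'rV[R]_n :=
  \row_i (i \in S)%:R.

Definition volume (R : pzRingType) n (e : rel 'I_n) (S : {set 'I_n}) : R :=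
  \sum_(v in S) (degree e v)%:R.

Lemma bform_indrv (R : pzRingType) n (M : 'M[R]_n) (S T : {set 'I_n}) :
  bform M (indrv R S) (indrv R T) = \sum_(j in T) \sum_(i in S) M i j.
Proof.
rewrite bformE [RHS]big_mkcond /=; apply: eq_bigr => j _.
rewrite mxE; case: (j \in T); last by rewrite mulr0.
rewrite mulr1 [RHS]big_mkcond /=; apply: eq_bigr => i _.
by rewrite mxE; case: (i \in S); rewrite ?mul1r ?mul0r.
Qed.

Lemma hoffmanmx_colsum (R : realType) n (e : rel 'I_n) k j :
  symmetric e -> \sum_i hoffmanmx R e k i j = k%:R * (degree e j)%:R.
Proof.
move=> e_sym; under eq_bigr do rewrite hoffmanmxE e_sym.
rewrite big_split /= -mulr_sumr sum_adj_degree (bigD1 j) //= eqxx mulr1n big1; first ring.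
by move=> i /negPf->.
Qed.

Lemma bform_hoffmanmx_setT (R : realType) n (e : rel 'I_n) k S :
    symmetric e ->
  bform (hoffmanmx R e k) (indrv R setT) (indrv R S) = k%:R * volume R e S.
Proof.
move=> e_sym; rewrite bform_indrv mulr_sumr; apply: eq_bigr => j _.
rewrite -hoffmanmx_colsum //; by apply: eq_bigl => i; rewrite inE.
Qed.

Lemma bform_hoffmanmx_independent (R : realType) n (e : rel 'I_n) k S :
    independent e S ->
  bform (hoffmanmx R e k) (indrv R S) (indrv R S) = volume R e S.
Proof.
move=> S_ind; rewrite bform_indrv; apply: eq_bigr => j jS.
rewrite (bigD1 j) //= hoffmanmxE eqxx (negPf (S_ind _ _ jS jS)) mulr0 addr0.
rewrite big1 ?addr0 // => i /andP[iS /negPf ij].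
by rewrite hoffmanmxE ij (negPf (S_ind _ _ iS jS)) mulr0 addr0.
Qed.

(** The vectors [1 - k 1_T], over all [k] classes [T], have nonnegative values
    under the form, and the sum of these values is
    [k * k vol V - k^2 vol V = 0]. *)
Lemma colour_class_ker (R : realType) n (e : rel 'I_n) k
    (pi : {set {set 'I_n}}) (S : {set 'I_n}) :
    symmetric e -> proper_colouring e k pi ->
    (forall x, 0 <= bform (hoffmanmx R e k) x x) -> S \in pi ->
  (indrv R setT - k%:R *: indrv R S) *m hoffmanmx R e k = 0.
Proof.
move=> e_sym [pi_part pi_card pi_ind] psd S_pi.
set K := hoffmanmx R e k in psd *.
pose f (T : {set 'I_n}) := indrv R setT - k%:R *: indrv R T.
have K_sym : K^T = K by exact: tr_hoffmanmx.
have qf T : T \in pi ->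
    bform K (f T) (f T) = k%:R * volume R e setT - k%:R ^+ 2 * volume R e T.
  move=> T_pi; rewrite /f -scaleNr !(bformDl, bformDr, bformZl, bformZr).
  rewrite (bform_sym (indrv R T) _ K_sym) !bform_hoffmanmx_setT //.
  rewrite bform_hoffmanmx_independent; first ring.
  exact: pi_ind.
have sum_qf : \sum_(T in pi) bform K (f T) (f T) = 0.
  rewrite (eq_bigr _ qf) big_split /= sumrN sumr_const pi_card -mulr_sumr.
  have -> : \sum_(T in pi) volume R e T = volume R e setT.
    case/and3P: pi_part => /eqP cover_pi triv_pi _.
    by rewrite /volume -cover_pi big_trivIset.
  rewrite -mulr_natl; ring.
apply: psd_isotropic_ker => //; apply/eqP.
have /eqP := sum_qf; rewrite psumr_eq0 => [/allP/(_ S)|T _]; last exact: psd.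
by rewrite mem_index_enum S_pi => /(_ isT).
Qed.

Lemma invmx_degmx (R : realType) n (e : rel 'I_n) :
    no_isolated e ->
  invmx (degmx R e) = diag_mx (\row_i (degree e i)%:R^-1).
Proof.
move=> e_noiso; set D' := diag_mx _.
have DD' : degmx R e *m D' = 1%:M.
  rewrite mulmx_diag -diag_const_mx; congr diag_mx; apply/rowP => i.
  by rewrite !mxE divff // pnatr_eq0 -lt0n degree_gt0.
have [D_unit _] := mulmx1_unit DD'.
by rewrite -[RHS](mulKmx D_unit) DD' mulmx1.
Qed.

Theorem theorem7 (R : realType) (n : nat) (e : rel 'I_n)
    (e_sym : symmetric e) (e_irr : irreflexive e) (e_noiso : no_isolated e)
    (k : nat) (k_ge2 : (2 <= k)%N)
    (pi : {set {set 'I_n}}) (pi_col : proper_colouring e k pi)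
    (lambda : R) (lambda_max : largest_eigenvalue (norm_laplacian R e) lambda)
    (lambda_eq : lambda = k%:R / (k%:R - 1)) :
  equitable (invmx (degmx R e) *m adjmx R e) pi.
Proof.
case: lambda_max => _; rewrite lambda_eq => L_le S T S_pi T_pi.
have psd := hoffmanmx_psd e_sym e_noiso k_ge2 L_le.
have k1 : k%:R - 1 != 0 :> R by rewrite subr_eq0 pnatr_eq1 gtn_eqF.
have k0 : k%:R != 0 :> R by rewrite pnatr_eq0; case: (k) k_ge2.
suff row_sum a : a \in S ->
    \sum_(b in T) (invmx (degmx R e) *m adjmx R e) a b
    = (1 - (S == T)%:R) / (k%:R - 1).
  by move=> a a' aS a'S; rewrite !row_sum.
move=> aS; have aT : (a \in T) = (S == T).
  case: pi_col => /and3P[_ triv_pi _] _ _.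
  apply/idP/eqP => [aT|<- //].
  by rewrite -(def_pblock triv_pi S_pi aS) (def_pblock triv_pi T_pi aT).
have d0 : (degree e a)%:R != 0 :> R by rewrite pnatr_eq0 -lt0n degree_gt0.
have -> : \sum_(b in T) (invmx (degmx R e) *m adjmx R e) a b
    = (degree e a)%:R^-1 * \sum_(b in T) (e a b)%:R.
  rewrite mulr_sumr; apply: eq_bigr => b _.
  by rewrite invmx_degmx // mul_diag_mx !mxE.
have := congr1 (fun v : 'rV[R]_n => v 0 a) (colour_class_ker e_sym pi_col psd T_pi).
rewrite mulmxBl -scalemxAl !mxE.
have -> : \sum_j (indrv R setT) 0 j * hoffmanmx R e k j a = k%:R * (degree e a)%:R.
  rewrite -hoffmanmx_colsum //.
  by apply: eq_bigr => j _; rewrite !mxE inE mul1r.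
have -> : \sum_j (indrv R T) 0 j * hoffmanmx R e k j a
    = (degree e a)%:R * (a \in T)%:R + (k%:R - 1) * \sum_(b in T) (e a b)%:R.
  rewrite mulr_sumr (big_mkcond (mem T)) /= (bigD1 a) //= [in RHS](bigD1 a) //=.
  rewrite addrA; congr (_ + _).
    by rewrite hoffmanmxE eqxx mxE mulr1n; case: (a \in T) => /=; ring.
  apply: eq_bigr => b /negPf ba.
  by rewrite hoffmanmxE ba mxE e_sym; case: (b \in T); rewrite ?mul1r ?mul0r ?add0r.
rewrite aT; move: (\sum_(b in T) _) => s /eqP.
rewrite -mulrBr mulf_eq0 (negPf k0) /= => /eqP s_eq.
have -> : s = (degree e a)%:R * (1 - (S == T)%:R) / (k%:R - 1).
  by apply: (mulfI k1); rewrite mulrCA divff // mulr1; lra.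
by rewrite !mulrA mulVf // mul1r.
Qed.
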